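(* For each $1\le i\le 7$, define $$\mathrm{supp}(i):=\bigl\{\{j,k\}:[e_j,e_k]_i\neq 0,\ 1\le j<k\le 7\bigr\}.$$ Then: (i) $|\mathrm{supp}(i)|=3$ for every $i$; (ii) the supports partition all $21$ pairs $\{\{j,k\}\mid 1\le j<k\le 7\}$; (iii) $\mathrm{supp}(i)=\bigl\{\{j,k\}:j+k=i\bigr\}=\bigl\{\{j,k\}:e_i\in\langle e_j,e_k\rangle\bigr\}$.
   Context: Let $\{e_1,\dots,e_7\}$ be an orthonormal basis of $\mathbb{R}^7$ with Euclidean inner product $\langle\cdot,\cdot\rangle$, dual basis $\omega^1,\dots,\omega^7$, and $\omega^{ijk}=\omega^i\wedge\omega^j\wedge\omega^k$. Let $$\Phi=\omega^{123}+\omega^{145}+\omega^{167}+\omega^{246}-\omega^{257}-\omega^{347}-\omega^{356},$$ and let $\times$ be the bilinear cross product on $\mathbb{R}^7$ characterized by $\langle u\times v,w\rangle=\Phi(u,v,w)$ for all $u,v,w$. For $1\le i\le 7$, the directional Vidinli algebra $\mathbb{V}_{7,i}$ is $\mathbb{R}^7$ with the product $$a\veebar_{e_i}b=\langle a,e_i\rangle b+\langle b,e_i\rangle a-\langle a,b\rangle e_i+\langle e_i,a\times b\rangle e_i,$$ and its commutator is $[a,b]_i=a\veebar_{e_i}b-b\veebar_{e_i}a=2\langle e_i,a\times b\rangle e_i$. The basis vectors are labeled by the nonzero elements of $(\mathbb{Z}/2)^3$ via $e_1\leftrightarrow(1,0,0)$, $e_2\leftrightarrow(0,1,0)$, $e_3\leftrightarrow(1,1,0)$,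 $e_4\leftrightarrow(0,0,1)$, $e_5\leftrightarrow(1,0,1)$, $e_6\leftrightarrow(0,1,1)$, $e_7\leftrightarrow(1,1,1)$. Indices are identified with their images, and $+$ is addition in $(\mathbb{Z}/2)^3$. In part (iii), $\{j,k\}$ denotes a pair of distinct indices in $\{1,\dots,7\}$, and $\langle e_j,e_k\rangle=\{0,e_j,e_k,e_{j+k}\}$ denotes the subgroup of $(\mathbb{Z}/2)^3$ generated by $e_j$ and $e_k$ (not an inner product).
   Formalization: In (iii), the last set is restricted to pairs {j,k} with i ≠ j and i ≠ k: read literally the second equality is false, e.g. e_1 ∈ ⟨e_1,e_2⟩ although 1+2 = 3 ≠ 1. *)

(* Defs.v *)
From HB Require Import structures.
From mathcomp Require Import all_boot all_order all_algebra all_fingroup.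
From mathcomp Require Import reals.
Set Implicit Arguments.
Unset Strict Implicit.
Unset Printing Implicit Defensive.
Import Order.TTheory GRing.Theory Num.Theory.
Local Open Scope ring_scope.

(* An index 1 <= n <= 7 is represented by the element n - 1 of 'I_7. *)
Definition idx (n : nat) : 'I_7 := inord n.-1.

Section Vidinli.
Variable R : realType.
Local Notation V := 'rV[R]_7.

Definition dot (u v : V) : R := \sum_(m < 7) u 0 m * v 0 m.

Definition orthonormal_basis (e : 7.-tuple V) : Prop :=
  basis_of fullv e /\ forall i j, dot (tnth e i) (tnth e j) = (i == j)%:R.

(* The convention is (a /\ b /\ c)(u, v, w) = det, without a factor 1/3!, *)
(* so that omega^{123}(e_1, e_2, e_3) = 1.                                *)
Definition wedge3 (a b c : V -> R) (u v w : V) : R :=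
  \det (\matrix_(r < 3, s < 3) (nth a [:: a; b; c] r) (nth u [:: u; v; w] s)).

(* coord e is the dual basis of e. *)
Definition omega3 (e : 7.-tuple V) (i j k : nat) : V -> V -> V -> R :=
  wedge3 (coord e (idx i)) (coord e (idx j)) (coord e (idx k)).

Definition Phi (e : 7.-tuple V) (u v w : V) : R :=
  omega3 e 1 2 3 u v w + omega3 e 1 4 5 u v w + omega3 e 1 6 7 u v w
  + omega3 e 2 4 6 u v w - omega3 e 2 5 7 u v w - omega3 e 3 4 7 u v w
  - omega3 e 3 5 6 u v w.

(* This determines cross uniquely and forces it to be bilinear. *)
Definition cross_product (e : 7.-tuple V) (cross : V -> V -> V) : Prop :=
  forall u v w, dot (cross u v) w = Phi e u v w.

Definition vidinli (cross : V -> V -> V) (x a b : V) : V :=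
  dot a x *: b + dot b x *: a - dot a b *: x + dot x (cross a b) *: x.

Definition vidinli_comm (cross : V -> V -> V) (x a b : V) : V :=
  vidinli cross x a b - vidinli cross x b a.

End Vidinli.

Definition vec3 (a b c : 'F_2) : 'rV['F_2]_3 :=
  \row_(s < 3) nth 0 [:: a; b; c] s.

Definition label (i : 'I_7) : 'rV['F_2]_3 :=
  nth 0 [:: vec3 1 0 0; vec3 0 1 0; vec3 1 1 0; vec3 0 0 1;
            vec3 1 0 1; vec3 0 1 1; vec3 1 1 1] i.

Definition pairs_with (P : 'I_7 -> 'I_7 -> bool) : {set {set 'I_7}} :=
  [set [set p.1; p.2] | p : 'I_7 * 'I_7 & (p.1 < p.2)%N && P p.1 p.2].

Definition all_pairs : {set {set 'I_7}} := pairs_with (fun _ _ => true).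

Definition supp (R : realType) (e : 7.-tuple 'rV[R]_7)
    (cross : 'rV[R]_7 -> 'rV[R]_7 -> 'rV[R]_7) (i : 'I_7) : {set {set 'I_7}} :=
  pairs_with (fun j k =>
    vidinli_comm cross (tnth e i) (tnth e j) (tnth e k) != 0).

Definition sum_pairs (i : 'I_7) : {set {set 'I_7}} :=
  pairs_with (fun j k => label j + label k == label i).

(* The group law of 'rV['F_2]_3 is addition. The index i is required to   *)
(* differ from j and k: otherwise e_i is trivially a member of            *)
(* <e_j, e_k>, and the set would have 9 elements instead of 3.            *)
Definition span_pairs (i : 'I_7) : {set {set 'I_7}} :=
  pairs_with (fun j k =>
    [&& i != j, i != k & label i \in <<[set label j; label k]>>%g]).

(* Main.v *)
Require Import Defs.
From mathcomp Require Import all_boot all_order all_algebra all_fingroup.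
From mathcomp Require Import reals.
From mathcomp Require Import ring.
Import GRing.Theory Num.Theory.
Local Open Scope ring_scope.

Set Implicit Arguments.
Unset Strict Implicit.

(** The commutator of [e_j] and [e_k] in the algebra directed by [e_i] is
    [2 * Phi (e_j, e_k, e_i)] times [e_i], because the other terms of the
    product are symmetric.  So membership in a support is a statement about the
    3-form: [Phi (e_j, e_k, e_i) != 0] holds exactly when [j], [k], [i] are, in
    some order, the indices of one of the seven monomials of [Phi].  These seven
    triples are the lines of the Fano plane: the labels of each triple add up to
    zero, and two distinct indices lie on exactly one of the triples.  Therefore
    the support of [i] consists of the pairs with [j + k = i] ([supp_sum_pairs]).

    The rest follows inside the group [(Z/2)^3].  The sum of two distinct
    nonzero labels is the label of a unique index, so every pair belongs to one
    and only one support; and [j + k] is the only nonzero element of the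
    subgroup generated by [j] and [k] besides [j] and [k] themselves.

    The incidence facts are checked by enumeration of the indices: the monomials
    of [Phi] are the lines ([phi_coef_neq0]), any two points are on a line
    ([fano_third_point]), and each point is on three lines ([card_sum_pairs]).
    To make this computable, the labels are replaced by the binary digits of
    [i + 1] ([label_addE]) and the values of [Phi] on the basis by integers
    ([Phi_basis]). *)

Lemma all_iota7 (P : pred nat) (i : 'I_7) : all P (iota 0 7) -> P i.
Proof. by move=> /allP; apply; rewrite mem_iota ltn_ord. Qed.

Lemma all2_iota7 (P : nat -> nat -> bool) (i j : 'I_7) :
  all (fun i => all (P i) (iota 0 7)) (iota 0 7) -> P i j.
Proof.
by move=> allP; apply: all_iota7; apply: (all_iota7 _ allP).
Qed.

(** * Families of pairs of indices *)

Lemma pair_set_inj n (i j k l : 'I_n) :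
  (i < j)%N -> (k < l)%N -> [set i; j] = [set k; l] -> (i, j) = (k, l).
Proof.
move=> lt_ij lt_kl eq_s.
have: i \in [set k; l] by rewrite -eq_s set21.
have: j \in [set k; l] by rewrite -eq_s set22.
case/set2P=> ej /set2P[] ei; subst i j; rewrite ?ltnn // in lt_ij *.
by rewrite ltnNge ltnW in lt_ij.
Qed.

Lemma pairs_withP (P : 'I_7 -> 'I_7 -> bool) A :
  reflect (exists j k : 'I_7, [/\ (j < k)%N, P j k & A = [set j; k]])
          (A \in pairs_with P).
Proof.
apply: (iffP imsetP) => [[[j k] /[!inE] /= /andP[ltjk Pjk] ->]|].
  by exists j, k.
by move=> [j [k [ltjk Pjk ->]]]; exists (j, k); rewrite ?inE /= ?ltjk.
Qed.

Lemma eq_pairs_with (P Q : 'I_7 -> 'I_7 -> bool) :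
  (forall j k : 'I_7, (j < k)%N -> P j k = Q j k) ->
  pairs_with P = pairs_with Q.
Proof.
move=> eqPQ; apply/setP=> A; apply/pairs_withP/pairs_withP=>
  -[j [k [ltjk Pjk ->]]]; exists j, k; split=> //; by rewrite ?eqPQ // -eqPQ.
Qed.

(** Counting over intervals of natural numbers, so that the right-hand side
    can be evaluated. *)
Lemma card_pairs_with (P : 'I_7 -> 'I_7 -> bool) (Q : nat -> nat -> bool) :
  (forall j k : 'I_7, P j k = Q j k) ->
  #|pairs_with P| =
    (\sum_(0 <= j < 7) \sum_(0 <= k < 7) ((j < k)%N && Q j k))%N.
Proof.
move=> eqPQ; rewrite card_in_imset => [|[j k] [j' k']]; last first.
  by rewrite !inE /= => /andP[lt _] /andP[lt' _]; apply: pair_set_inj.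
rewrite -sum1_card big_mkord.
under [RHS]eq_bigr do rewrite big_mkord.
rewrite pair_big /= big_mkcond; apply: eq_bigr => -[j k] _ /=.
by rewrite inE /= eqPQ; case: ifP.
Qed.

Lemma card_all_pairs : #|all_pairs| = 21%N.
Proof. by rewrite (@card_pairs_with _ (fun _ _ => true)) // unlock. Qed.

(** * The labels *)

(** The label of the index at position [n] lists the binary digits of [n + 1],
    lowest digit first. *)
Definition digit (s n : nat) : bool := odd (n.+1 %/ 2 ^ s).

Lemma labelE (i : 'I_7) : label i = \row_(s < 3) (digit s i)%:R.
Proof.
apply/rowP=> s; rewrite /label mxE.
case: i => i /= lti; case: s => s /= lts.
do 7?[case: i lti => [|i] lti //=]; rewrite ?mxE /=;
by do 3?[case: s lts => [|s] lts //=].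
Qed.

Definition fano_line (j k i : nat) : bool :=
  all (fun s => digit s j (+) digit s k == digit s i) (iota 0 3).

Lemma label_addE (i j k : 'I_7) :
  (label j + label k == label i) = fano_line j k i.
Proof.
have F2E (a b c : bool) : (a%:R + b%:R == c%:R :> 'F_2) = (a (+) b == c).
  by case: a; case: b; case: c.
rewrite !labelE; apply/eqP/allP=> [/rowP eq_s s | eq_s].
  rewrite mem_iota => lts; have := eq_s (Ordinal lts).
  by rewrite !mxE => /eqP; rewrite F2E.
apply/rowP=> s; rewrite !mxE; apply/eqP; rewrite F2E.
by apply: eq_s; rewrite mem_iota ltn_ord.
Qed.

Lemma label_inj : injective label.
Proof.
move=> i j eq_ij; apply/val_inj/eqP.
have: all (fun s => digit s i == digit s j) (iota 0 3).
  apply/allP=> s; rewrite mem_iota => lts.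
  have /rowP/(_ (Ordinal lts)) := eq_ij; rewrite !labelE !mxE /=.
  by case: (digit s i); case: (digit s j).
apply/implyP; pose P i j := all (fun s => digit s i == digit s j) (iota 0 3)
  ==> (i == j).
by apply: (@all2_iota7 P); vm_compute.
Qed.

Lemma label_double (i : 'I_7) : label i + label i = 0.
Proof.
apply/rowP=> s; rewrite labelE !mxE.
by case: (digit s i); apply: val_inj.
Qed.

Lemma label_neq0 (i : 'I_7) : label i != 0.
Proof.
rewrite -(label_double i) eq_sym label_addE.
apply: (@all_iota7 (fun i => ~~ fano_line i i i)).
by vm_compute.
Qed.

Lemma fano_third_point (j k : 'I_7) :
  (j < k)%N -> exists i, label j + label k = label i.
Proof.
move=> ltjk; suff /hasP[i]: has (fano_line j k) (iota 0 7).
  by rewrite mem_iota => lti fano_i; exists (Ordinal lti);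
     apply/eqP; rewrite label_addE.
apply: (implyP _ ltjk).
pose P j k := (j < k)%N ==> has (fano_line j k) (iota 0 7).
by apply: (@all2_iota7 P); vm_compute.
Qed.

Lemma card_sum_pairs (i : 'I_7) : #|sum_pairs i| = 3%N.
Proof.
rewrite (@card_pairs_with _ (fun j k => fano_line j k i)) => [|j k]; last first.
  exact: label_addE.
apply/eqP.
apply: (@all_iota7 (fun i => \sum_(0 <= j < 7) \sum_(0 <= k < 7)
  ((j < k)%N && fano_line j k i) == 3)%N).
by rewrite unlock; vm_compute.
Qed.

(** The pair determines its two labels, hence their sum, hence the index that
    carries the sum as its label. *)
Lemma sum_pairs_disjoint (i i' : 'I_7) A :
  A \in sum_pairs i -> A \in sum_pairs i' -> i = i'.
Proof.
move=> /pairs_withP[j [k [ltjk /eqP eq_i ->]]].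
move=> /pairs_withP[j' [k' [ltjk' /eqP eq_i' eqA]]].
have [ej ek] := pair_set_inj ltjk ltjk' eqA; subst j' k'.
by apply: label_inj; rewrite -eq_i.
Qed.

Lemma sum_pairs_inj : injective sum_pairs.
Proof.
move=> i i' eq_ii'.
have /card_gt0P[A Ai]: (0 < #|sum_pairs i|)%N by rewrite card_sum_pairs.
by apply: (@sum_pairs_disjoint i i' A); rewrite -?eq_ii'.
Qed.

Lemma sum_pairs_partition : partition [set sum_pairs i | i : 'I_7] all_pairs.
Proof.
apply/and3P; split.
- rewrite cover_imset; apply/eqP/setP=> A; apply/bigcupP/pairs_withP.
    by move=> [i _ /pairs_withP[j [k [ltjk _ ->]]]]; exists j, k.
  move=> [j [k [ltjk _ ->]]]; have [i eq_i] := fano_third_point ltjk.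
  by exists i => //; apply/pairs_withP; exists j, k; rewrite eq_i.
- apply/trivIsetP=> _ _ /imsetP[i _ ->] /imsetP[i' _ ->] neq.
  apply/pred0P=> A /=; apply: contraNF neq => /andP[Ai Ai'].
  by rewrite (sum_pairs_disjoint Ai Ai').
- apply/imsetP=> -[i _ eq0].
  by have := card_sum_pairs i; rewrite -eq0 cards0.
Qed.

(** The right-hand side is closed under addition because it consists of the
    linear combinations of [a] and [b] with coefficients in the field [Z/2]. *)
Lemma mem_gen2 n (a b x : 'rV['F_2]_n) :
  (x \in <<[set a; b]>>%g) = (x \in [:: 0; a; b; a + b]).
Proof.
pose comb := [set c.1 *: a + c.2 *: b | c : 'F_2 * 'F_2].
have comb_group : group_set comb.
  apply/group_setP; split.
    by apply/imsetP; exists (0, 0); rewrite // !scale0r addr0.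
  move=> _ _ /imsetP[c _ ->] /imsetP[d _ ->]; apply/imsetP.
  exists (c.1 + d.1, c.2 + d.2) => //=.
  by rewrite !scalerDl addrACA.
have F2P (c : 'F_2) : c = 0 \/ c = 1.
  by case: c => -[|[|//]] lt; [left | right]; apply: val_inj.
apply/idP/idP=> [|].
  have: <<[set a; b]>>%g \subset Group comb_group.
    rewrite gen_subG; apply/subsetP=> y /set2P[] ->; apply/imsetP.
      by exists (1, 0); rewrite // scale1r scale0r addr0.
    by exists (0, 1); rewrite // scale1r scale0r add0r.
  move=> /subsetP sub /sub /imsetP[[c d] _ ->]; rewrite !inE /=.
  by case: (F2P c) => ->; case: (F2P d) => ->;
    rewrite ?scale1r ?scale0r ?addr0 ?add0r eqxx ?orbT.
have ga : a \in <<[set a; b]>>%g by rewrite mem_gen ?set21.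
have gb : b \in <<[set a; b]>>%g by rewrite mem_gen ?set22.
rewrite !inE => /or4P[] /eqP-> //; first exact: group1.
exact: groupM.
Qed.

(** Of the four elements of the subgroup, 0 is not a label, and [label j] and
    [label k] are excluded by [i != j] and [i != k]; this leaves the sum, which
    differs from both since neither label is 0. *)
Lemma sum_span_pairs (i : 'I_7) : sum_pairs i = span_pairs i.
Proof.
apply: eq_pairs_with => j k ltjk.
rewrite mem_gen2 !inE (negPf (label_neq0 i)) !(inj_eq label_inj) /= eq_sym.
have [-> | _] := eqVneq i j.
  apply/negbTE; rewrite -subr_eq0 opprD addrA subrr sub0r oppr_eq0.
  exact: label_neq0.
have [-> | _] := eqVneq i k.
  apply/negbTE; rewrite -subr_eq0 opprD addrCA subrr addr0 oppr_eq0.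
  exact: label_neq0.
by [].
Qed.

(** * The three-form on the basis *)

Lemma wedge3E (R : realType) (a b c : 'rV[R]_7 -> R) u v w :
  wedge3 a b c u v w =
    a u * (b v * c w - b w * c v) - a v * (b u * c w - b w * c u)
    + a w * (b u * c v - b v * c u).
Proof.
rewrite /wedge3 (expand_det_row _ ord0) !big_ord_recl big_ord0.
rewrite /cofactor !(expand_det_row _ ord0) !big_ord_recl !big_ord0.
rewrite /cofactor !det_mx11 !mxE /=.
rewrite /bump /= !(expr0, expr1, exprS); ring.
Qed.

Lemma Phi_antisym (R : realType) (e : 7.-tuple 'rV[R]_7) u v w :
  Phi e v u w = - Phi e u v w.
Proof. rewrite /Phi /omega3 !wedge3E; ring. Qed.

(** The value of the form [omega^abc], with indices from 1 to 7, on the basis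
    vectors of positions [j], [k], [i], which are counted from 0: the
    determinant of the matrix of Kronecker deltas. *)
Definition omega_coef (a b c j k i : nat) : int :=
  let d m n : int := (n == m.-1)%:R in
    d a j * (d b k * d c i - d b i * d c k)
    - d a k * (d b j * d c i - d b i * d c j)
    + d a i * (d b j * d c k - d b k * d c j).

Definition phi_coef (j k i : nat) : int :=
  omega_coef 1 2 3 j k i + omega_coef 1 4 5 j k i + omega_coef 1 6 7 j k i
  + omega_coef 2 4 6 j k i - omega_coef 2 5 7 j k i - omega_coef 3 4 7 j k i
  - omega_coef 3 5 6 j k i.

Lemma omega3_basis (R : realType) (e : 7.-tuple 'rV[R]_7) (a b c : nat)
    (j k i : 'I_7) :
  basis_of fullv e -> (a.-1 < 7)%N -> (b.-1 < 7)%N -> (c.-1 < 7)%N ->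
  omega3 e a b c (tnth e j) (tnth e k) (tnth e i)
    = (omega_coef a b c j k i)%:~R.
Proof.
move=> /basis_free free_e lta ltb ltc.
have coordE n (j' : 'I_7) : (n.-1 < 7)%N ->
    coord e (idx n) (tnth e j') = ((j' == n.-1 :> nat)%:R : int)%:~R.
  move=> ltn; rewrite (tnth_nth 0) coord_free // -val_eqE /= inordK //.
  by case: eqP.
rewrite /omega3 !wedge3E !coordE // /omega_coef.
by rewrite !(rmorphD, rmorphN, rmorphM).
Qed.

Lemma Phi_basis (R : realType) (e : 7.-tuple 'rV[R]_7) (j k i : 'I_7) :
  basis_of fullv e ->
  Phi e (tnth e j) (tnth e k) (tnth e i) = (phi_coef j k i)%:~R.
Proof.
by move=> basis_e; rewrite /Phi !omega3_basis // -!(rmorphD, rmorphB).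
Qed.

(** The monomials of [Phi] are the seven lines of the Fano plane, and a monomial
    takes the value 1 or -1 on the basis vectors of its own line and 0 on all
    others, so no cancellation occurs between monomials. *)
Lemma phi_coef_neq0 (j k i : 'I_7) :
  (j < k)%N -> (phi_coef j k i != 0) = fano_line j k i.
Proof.
pose P j k i := ((j < k) ==> ((phi_coef j k i != 0) == fano_line j k i))%N.
suff /implyP Pjki: P j k i by move=> /Pjki/eqP.
apply: (@all_iota7 (P j k)).
by apply: (@all2_iota7 (fun j k => all (P j k) (iota 0 7))); vm_compute.
Qed.

(** * The commutators *)

Lemma dotC (R : realType) (u v : 'rV[R]_7) : dot u v = dot v u.
Proof. by apply: eq_bigr => m _; rewrite mulrC. Qed.

(** The sum of the first three terms of the product is unchanged when [a] and
    [b] are exchanged, and the last one changes sign. *)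
Lemma vidinli_commE (R : realType) (e : 7.-tuple 'rV[R]_7)
    (cross : 'rV[R]_7 -> 'rV[R]_7 -> 'rV[R]_7) x a b :
  cross_product e cross ->
  vidinli_comm cross x a b = (2 * Phi e a b x) *: x.
Proof.
move=> hcross; rewrite /vidinli_comm /vidinli.
rewrite (dotC x (cross a b)) (dotC x (cross b a)) !hcross.
rewrite (Phi_antisym e a b) (dotC b a).
rewrite (addrC (dot b x *: a)) opprD addrACA subrr add0r.
by rewrite -scalerBl opprK mulr_natl mulr2n.
Qed.

Lemma vidinli_comm_neq0 (R : realType) (e : 7.-tuple 'rV[R]_7)
    (cross : 'rV[R]_7 -> 'rV[R]_7 -> 'rV[R]_7) (i j k : 'I_7) :
  orthonormal_basis e -> cross_product e cross -> (j < k)%N ->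
  (vidinli_comm cross (tnth e i) (tnth e j) (tnth e k) != 0)
    = (label j + label k == label i).
Proof.
move=> [basis_e dot_e] hcross ltjk; rewrite (vidinli_commE _ _ _ hcross).
have ei_neq0 : tnth e i != 0.
  apply: contra_eq_neq (dot_e i i) => ->.
  rewrite /dot eqxx big1 => [|m _]; last by rewrite mxE mul0r.
  by rewrite eq_sym oner_eq0.
rewrite scaler_eq0 (negPf ei_neq0) orbF mulf_eq0 pnatr_eq0 /=.
by rewrite Phi_basis // intr_eq0 phi_coef_neq0 // label_addE.
Qed.

Lemma supp_sum_pairs (R : realType) (e : 7.-tuple 'rV[R]_7)
    (cross : 'rV[R]_7 -> 'rV[R]_7 -> 'rV[R]_7) :
  orthonormal_basis e -> cross_product e cross ->
  supp e cross =1 sum_pairs.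
Proof.
move=> he hcross i; apply: eq_pairs_with => j k ltjk.
exact: vidinli_comm_neq0.
Qed.

Theorem theorem4p8 (R : realType) (e : 7.-tuple 'rV[R]_7)
    (cross : 'rV[R]_7 -> 'rV[R]_7 -> 'rV[R]_7)
    (he : orthonormal_basis e) (hcross : cross_product e cross) :
  [/\ forall i : 'I_7, #|supp e cross i| = 3%N,
      [/\ #|all_pairs| = 21%N,
          injective (supp e cross) &
          partition [set supp e cross i | i : 'I_7] all_pairs] &
      forall i : 'I_7,
        supp e cross i = sum_pairs i /\ sum_pairs i = span_pairs i].
Proof.
have suppE := supp_sum_pairs he hcross.
split=> [i||i]; first by rewrite suppE card_sum_pairs.
  split; first exact: card_all_pairs.
    by apply: eq_inj sum_pairs_inj _ => i; rewrite suppE.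
  by rewrite (eq_imset _ suppE) sum_pairs_partition.
by rewrite suppE -sum_span_pairs.
Qed.
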